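(* Let $E$ be a Banach space, let $D \subset E^{\ast}$ be a weak$^\ast$-compact convex set with $0 \notin D$ and let $B \subset E^{\ast}$ be a (possibly unbounded) set with the following property: for every $x \in L_{D}$ there is $b^{\ast} \in B$ with $\langle x, b^{\ast} \rangle = \sup_{c^\ast\in B}\langle x,c^\ast\rangle$. If $B \subset \bigcup_{n=1}^{\infty}K_{n}$ for some family $(K_n)_{n\ge 1}$ of weak$^\ast$-compact convex subsets of $\overline{\operatorname{co}(B)}^{\omega^{\ast}}$, then \[ \overline{\operatorname{co}(B)}^{\omega^{\ast}} \subset \overline{\operatorname{co}\Big(\bigcup_{n=1}^{\infty}K_{n}\Big) + \Lambda_{D}}^{\| \cdot \|}. \]
   Context: Banach spaces are real. For $D \subset E^\ast$: if $D\neq\emptyset$, $L_D := \{x \in E : \sup_{d^\ast\in D}\langle x,d^\ast\rangle < 0\}$; if $D = \emptyset$ (allowed), $L_\emptyset := E\setminus\{0\}$. $\Lambda_D := \{0\}\cup\{\lambda d^\ast : \lambda>0,\ d^\ast\in D\}$ (so $\Lambda_\emptyset=\{0\}$). $\operatorname{co}(S)$ is the convex hull of $S$; $\overline{S}^{\omega^\ast}$ and $\overline{S}^{\|\cdot\|}$ are the weak$^\ast$ ($\sigma(E^\ast,E)$) and norm closures of $S$ in $E^\ast$. *)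

(* Defs.v *)
From HB Require Import structures.
From mathcomp Require Import all_boot all_order all_algebra.
From mathcomp Require Import all_classical all_reals all_analysis.

Set Implicit Arguments.
Unset Strict Implicit.
Unset Printing Implicit Defensive.

Import Order.TTheory GRing.Theory Num.Theory.
Import numFieldNormedType.Exports.

Local Open Scope classical_set_scope.
Local Open Scope ring_scope.

(* The topological dual of E. The default topology on [topdual E] is that of
   the operator norm; the weak* topology lives on the alias [weak_star E]. *)
Section topdual.
Context {R : realType} (E : normedModType R).

Definition clinear : {pred (E -> R^o)} :=
  [pred f | `[< linear f /\ continuous f >]].

Lemma clinearP (f : E -> R^o) :
  reflect (linear f /\ continuous f) (f \in clinear).
Proof. exact: asboolP. Qed.

Lemma clinear_submod_closed : submod_closed clinear.
Proof.
split.
  apply/clinearP; split => [a x y|x]; last exact: cvg_cst.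
  by rewrite scaler0 addr0.
move=> a f g /clinearP[lf cf] /clinearP[lg cg]; apply/clinearP; split.
  move=> k x y.
  rewrite [LHS]/(a *: f (k *: x + y) + g (k *: x + y)).
  by rewrite lf lg !scalerDr addrACA !scalerA [a * k]mulrC.
by move=> x; apply: cvgD; [apply: cvgZr; exact: cf|exact: cg].
Qed.

HB.instance Definition _ :=
  GRing.isSubmodClosed.Build R (E -> R^o) clinear clinear_submod_closed.

Record topdual := TopDual {
  topdual_fun :> E -> R^o;
  topdualP : topdual_fun \in clinear }.

HB.instance Definition _ := [isSub of topdual for topdual_fun].
HB.instance Definition _ := [Choice of topdual by <:].
HB.instance Definition _ := [SubChoice_isSubLmodule of topdual by <:].

Implicit Types f g : topdual.

Lemma topdual_linear f : linear f.
Proof. by have /clinearP[] := topdualP f. Qed.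

Lemma topdual_continuous f : continuous f.
Proof. by have /clinearP[] := topdualP f. Qed.

HB.instance Definition _ f :=
  GRing.isLinear.Build R E R^o _ (topdual_fun f) (topdual_linear f).

Definition dual_norm f : R := sup [set `|f x| | x in [set x | `|x| <= 1]].

Lemma topdual_has_sup f : has_sup [set `|f x| | x in [set x | `|x| <= 1]].
Proof.
split; first by exists `|f 0|, 0 => //=; rewrite normr0.
have /(linear_bounded_continuous (topdual_fun f))/bounded_funP/(_ 1)[M fM] :=
  @topdual_continuous f.
by exists M => _ [x x1 <-]; exact: fM.
Qed.

Lemma dual_norm_ub f x : `|x| <= 1 -> `|f x| <= dual_norm f.
Proof.
by move=> x1; apply: (sup_upper_bound (topdual_has_sup f)); exists x.
Qed.

Lemma dual_norm_le f M :
  (forall x, `|x| <= 1 -> `|f x| <= M) -> dual_norm f <= M.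
Proof.
move=> fM; apply: ge_sup; first by case: (topdual_has_sup f).
by move=> _ [x x1 <-]; exact: fM.
Qed.

Lemma dual_norm_ge0 f : 0 <= dual_norm f.
Proof.
by apply: le_trans (dual_norm_ub f (x := 0) _); rewrite ?normr_ge0 ?normr0.
Qed.

Lemma dual_normD f g : dual_norm (f + g) <= dual_norm f + dual_norm g.
Proof.
apply: dual_norm_le => x x1.
by rewrite (le_trans (ler_normD _ _))// lerD// dual_norm_ub.
Qed.

Lemma dual_normZ_le (a : R) f : dual_norm (a *: f) <= `|a| * dual_norm f.
Proof.
apply: dual_norm_le => x x1.
have -> : (a *: f) x = a * f x by [].
by rewrite normrM ler_wpM2l// dual_norm_ub.
Qed.

Lemma dual_normZ (a : R) f : dual_norm (a *: f) = `|a| * dual_norm f.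
Proof.
apply/eqP; rewrite eq_le dual_normZ_le/=.
have [->|a0] := eqVneq a 0; first by rewrite normr0 mul0r dual_norm_ge0.
rewrite -ler_pdivlMl ?normr_gt0// -normfV.
by rewrite -{1}[f](scalerK a0) dual_normZ_le.
Qed.

Lemma dual_norm0_eq0 f : dual_norm f = 0 -> f = 0.
Proof.
move=> f0; apply/val_inj/funext => x /=.
have [->|x0] := eqVneq x 0; first by rewrite linear0.
have := @dual_norm_ub f (`|x|^-1 *: x).
rewrite f0 normrZ normfV normr_id mulVf ?normr_eq0// lexx => /(_ isT).
rewrite normr_le0 linearZ/= scaler_eq0 invr_eq0 normr_eq0 (negbTE x0)/=.
by move/eqP.
Qed.

HB.instance Definition _ := Lmodule_isNormed.Build R topdual
  dual_normD dual_normZ dual_norm0_eq0.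

(* Coarsest topology making every evaluation [f |-> f x] continuous. *)
Definition weak_star : Type := topdual.
HB.instance Definition _ := GRing.Lmodule.on weak_star.
HB.instance Definition _ := Topological.copy weak_star
  (initial_topology (topdual_fun : topdual -> {ptws E -> R^o})).

Implicit Types A D : set topdual.

Definition weak_star_compact A := compact (A : set weak_star).

Definition weak_star_closure A : set topdual := closure (A : set weak_star).

Definition convex_hull A : set topdual :=
  smallest (@convex_set R topdual) A.

(* The supremum of the empty family would make L_ set0 the whole of E; the
   convention here excludes 0. *)
Definition L_ D : set E :=
  if `[< D = set0 >] then ~` [set 0]
  else [set x | (ereal_sup [set (d x)%:E | d in D] < 0)%E].

Definition Lambda_ D : set topdual :=
  [set 0] `|` [set l *: d | l in [set l : R | 0 < l] & d in D].

End topdual.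

(* Main.v *)
Require Import Defs.
From HB Require Import structures.
From mathcomp Require Import all_boot all_order all_algebra.
From mathcomp Require Import all_classical all_reals all_analysis.
From mathcomp Require Import ring lra.

Set Implicit Arguments.
Unset Strict Implicit.
Unset Printing Implicit Defensive.

Import Order.TTheory GRing.Theory Num.Theory.
Import numFieldNormedType.Exports.

Local Open Scope classical_set_scope.
Local Open Scope ring_scope.

(** Suppose that [f0] lies in the weak-star closed convex hull of [B] but at
    norm distance more than [r] from [co (\bigcup_n K n) + Lambda_ D].

    Let [X n] be the set of the [x] in the unit ball of [E] that are [<= 0] on
    [D] and such that [f x - f0 x <= - r] for all [f] in [K 0, ..., K n], and
    let [U] be the set of the [x] with [sup_D x < 0].  The [X n] form a
    decreasing sequence of closed convex sets, and each meets [U]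
    ([cone_separation]).  This is a minimax theorem for functions on a weak-star
    compact convex set: a point of that set is a mixture of some [m - f0 + r],
    with [m] in the hull of finitely many [K i], and of some [d] in [D]; up to a
    positive factor it is [m + l - f0 + r] with [l] in the cone of [D], and as
    the norm of [m + l - f0] exceeds [r], this function is negative at some [x]
    of the unit ball (so is [d] alone, because [d] is not [0]).  [compact_minimax] turns
    the choice of one [x] per point into a single [x] for all points; working
    with the predual ball directly avoids the bidual and any extension theorem.

    On [U] the set [B - f0] attains its supremum [p x], which is [>= 0] because
    [f0] is in the closed hull of [B].  Simons' construction
    ([simons_inequality]) then produces a point [z] of [U], a series
    [\sum_n 2^-n.+1 y_n] whose terms [y_n] in [X n] are chosen so as to almost
    minimise [p] step by step, such that a functional [b - f0] that attains
    [p z] satisfies [- r < (b - f0) x] for some [x] in every [X n].  But [b]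
    belongs to some [K n], so that [(b - f0) x <= - r] on [X n]: a
    contradiction. *)

(** * Compact convex sets of functions and a minimax theorem *)

(** Compactness by open covers is stated for pointed spaces. *)
HB.instance Definition _ (R : realType) (T : Type) :=
  isPointed.Build {ptws T -> R} (fun=> 0).

Section pointwise.
Context {R : realType} {T : choiceType}.
Local Notation fcts := {ptws T -> R}.
Implicit Types (f g : fcts) (A B : set fcts).

Definition mix (s : R) f g : fcts := fun x => (1 - s) * f x + s * g x.

Definition mix_closed A := forall s f g,
  0 <= s <= 1 -> A f -> A g -> A (mix s f g).

Lemma eval_continuous (x : T) : continuous (fun f => f x).
Proof. exact: (@proj_continuous T (fun=> R) x). Qed.

Lemma continuous_ptws (S : topologicalType) (F : S -> fcts) :
  (forall x, continuous (fun s => F s x)) -> continuous F.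
Proof.
move=> cF s; apply/cvg_sup => x; apply/cvg_image => //.
  by rewrite eqEsubset; split=> // y _; exists (fun=> y).
move=> A /cF As; exists [set f | A (f x)] => //.
rewrite eqEsubset; split=> [_ [f Af <-]//|y Ay].
by exists (fun=> y).
Qed.

(** Compactness leaves finitely many points [xs].  A minimiser [f0] on [A] of
    [N f = \sum_(x <- xs) (f x)^-^2], where [u^-] is the negative part, has
    [N f0 > 0].  The first-order condition at [f0] along the segment to [f] reads
    [\sum_(x <- xs) (f0 x)^- * (f x - f0 x) <= 0], that is,
    [\sum_(x <- xs) (f0 x)^- * f x <= - N f0]: the negative parts at [f0],
    normalised, are the weights. *)
Lemma compact_minimax A (X : set T) : compact A -> mix_closed A -> A !=set0 ->
  (forall f, A f -> exists2 x, X x & f x < 0) ->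
  exists (xs : seq T) (c : T -> R) (e : R),
    [/\ {in xs, forall x, X x}, forall x, 0 <= c x, \sum_(x <- xs) c x = 1,
        0 < e & forall f, A f -> \sum_(x <- xs) c x * f x <= - e].
Proof.
move=> cA mA A0 Aneg.
have [xs xsX Axs] : exists2 xs : seq T, {in xs, forall x, X x} &
    forall f, A f -> exists2 x, x \in xs & f x < 0.
  move: cA; rewrite compact_cover => /(_ T X (fun x => [set f | f x < 0])).
  case=> [x _|f /Aneg[x Xx fx]|xs xsX Axs]; last first.
    by exists (finmap.enum_fset xs) => // x /xsX; rewrite inE.
    by exists x.
  apply: (@open_comp _ _ (fun f : fcts => f x) [set y | y < 0]).
    by move=> f _; exact: eval_continuous.
  exact: open_lt.
pose neg f x : R := Num.max 0 (- f x).
pose N f := \sum_(x <- xs) neg f x ^+ 2.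
have cN : continuous N.
  apply: (@continuous_big R T +%R) => [|x _]; first exact: add_continuous.
  move=> f; apply: (@continuous_comp _ _ _ (fun g : fcts => neg g x)
    (fun u : R => u ^+ 2)); last exact: exprn_continuous.
  apply: continuous_max; first exact: cst_continuous.
  by apply: continuousN; exact: eval_continuous.
have [f0 /set_mem Af0 minf0] := compact_EVT_min A0 cA (continuous_subspaceT cN).
have neg_ge0 f x : 0 <= neg f x by rewrite le_max lexx.
pose c := neg f0.
have N0 : 0 < N f0.
  have [x xxs fx] := Axs _ Af0.
  rewrite /N (big_rem x)//= ltr_wpDr ?sumr_ge0// => [y _|].
    exact: sqr_ge0.
  by rewrite exprn_gt0// /neg lt_max oppr_gt0 fx orbT.
have grad f : A f -> 0 <= - \sum_(x <- xs) c x * (f x - f0 x).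
  move=> Af.
  set S := \sum_(x <- xs) _; pose V := \sum_(x <- xs) (f x - f0 x) ^+ 2.
  have V0 : 0 <= V by apply: sumr_ge0 => x _; exact: sqr_ge0.
  have key (t : R) : 0 <= t <= 1 -> 0 <= t * (t * V - 2 * S).
    move=> t01; have := minf0 (mix t f0 f); rewrite inE.
    move=> /(_ (mA _ _ _ t01 Af0 Af)).
    (* With [v^-] the negative part, [(u^-)^2 <= (v^- - (u - v))^2], and both
       sides agree to first order at [u = v]. *)
    have E : \sum_(x <- xs) (c x - t * (f x - f0 x)) ^+ 2 =
       N f0 + t * (t * V - 2 * S).
      rewrite mulrBr /V /S /N !mulr_sumr -sumrB -big_split /=.
      by apply: eq_bigr => x _; rewrite /c; ring.
    move=> Nf; rewrite -(lerD2l (N f0)) addr0 -E; apply: le_trans Nf _.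
    apply: ler_sum => x _; rewrite -[leRHS]real_normK ?num_real//.
    apply: lerXn2r; rewrite ?nnegrE//.
    rewrite /neg /mix ge_max normr_ge0/= /c /neg.
    have [h|h] := leP 0 (- f0 x); apply: le_trans (ler_norm _); first lra.
    by move/andP: t01 => [t0 t1]; lra.
  rewrite oppr_ge0 leNgt; apply/negP => S0.
  (* A step with [t * (1 + V) <= S] makes [t * V - 2 * S] negative. *)
  pose t := Num.min 1 (S / (1 + V)).
  have V1 : 0 < 1 + V by rewrite ltr_pwDl.
  have t0 : 0 < t by rewrite lt_min ltr01 divr_gt0.
  have : 0 <= t <= 1 by rewrite ltW//= ge_min lexx.
  move/key; rewrite pmulr_rge0//.
  have : t * (1 + V) <= S by rewrite -ler_pdivlMr// ge_min lexx orbT.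
  by nra.
pose C := \sum_(x <- xs) c x.
have C0 : 0 < C.
  rewrite lt_neqAle eq_sym (sumr_ge0 _ (fun x _ => neg_ge0 f0 x)) andbT.
  apply/eqP => C0.
  move: N0; rewrite /N big1_seq ?ltxx// => x /andP[_ xxs].
  have : c x <= C.
    by rewrite /C (big_rem x)//= lerDl sumr_ge0// => y _; exact: neg_ge0.
  rewrite C0 => cx; rewrite (_ : neg f0 x = 0) ?expr0n//.
  by apply: le_anti; rewrite cx neg_ge0.
exists xs, (fun x => c x / C), (N f0 / C); split=> //.
- by move=> x; rewrite divr_ge0 ?neg_ge0// ltW.
- by rewrite -mulr_suml divff// gt_eqF.
- exact: divr_gt0.
move=> f Af; under eq_bigr do rewrite mulrAC.
rewrite -mulr_suml -mulNr ler_pM2r ?invr_gt0//.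
have := grad _ Af; rewrite -sumrN.
suff -> : \sum_(x <- xs) - (c x * (f x - f0 x)) =
    - (N f0) - \sum_(x <- xs) c x * f x.
  by lra.
rewrite /N -!sumrN -big_split /=; apply: eq_bigr => x _; rewrite /c /neg.
by have [h|h] := leP 0 (- f0 x); ring.
Qed.

Lemma weight_split (a b : R) : 0 <= a -> 0 <= b ->
  exists2 s, 0 <= s <= 1 & (a + b) * s = b.
Proof.
move=> a0 b0; have [ab|ab] := eqVneq (a + b) 0.
  by exists 0; rewrite ?lexx ?ler01// mulr0; lra.
exists (b / (a + b)); last by rewrite mulrCA divff// mulr1.
have ab0 : 0 < a + b by rewrite lt_neqAle eq_sym ab addr_ge0.
by rewrite divr_ge0 ?(ltW ab0)//= ler_pdivrMr// mul1r lerDr.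
Qed.

(** When both sets are nonempty, [W] is the image of [`[0, 1] * A * B] under
    [mix]; the three cases of the last clause also cover an empty [A] or [B]. *)
Lemma compact_join A B : compact A -> mix_closed A -> compact B ->
  mix_closed B ->
  exists W : set fcts, [/\ compact W, mix_closed W, A `<=` W, B `<=` W &
    forall h, W h -> [\/ A h, B h | exists (s : R) f g,
      [/\ 0 <= s <= 1, A f, B g & h = mix s f g]]].
Proof.
move=> cA mA cB mB.
have [->|/set0P[f0 Af0]] := eqVneq A set0.
  by exists B; split=> // h Bh; apply: Or32.
have [->|/set0P[g0 Bg0]] := eqVneq B set0.
  by exists A; split=> // h Ah; apply: Or31.
pose W := [set mix p.1 p.2.1 p.2.2 | p in `[0, 1] `*` (A `*` B)].
have inW s f g : 0 <= s <= 1 -> A f -> B g -> W (mix s f g).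
  by move=> s01 Af Bg; exists (s, (f, g)); rewrite //= in_itv.
exists W; split.
- apply: continuous_compact; last first.
    by apply: compact_setX; [exact: segment_compact|exact: compact_setX].
  apply: continuous_subspaceT; apply: continuous_ptws => x p.
  apply: cvgD; apply: cvgM.
  + by apply: cvgB; [exact: cvg_cst|exact: cvg_fst].
  + apply: (@continuous_comp (R * (fcts * fcts))%type fcts R (fun q => q.2.1)
        (fun f => f x)).
      apply: (@continuous_comp _ _ _ snd fst); first exact: cvg_snd.
      exact: cvg_fst.
    exact: eval_continuous.
  + exact: cvg_fst.
  + apply: (@continuous_comp (R * (fcts * fcts))%type fcts R (fun q => q.2.2)
        (fun f => f x)).
      by apply: (@continuous_comp _ _ _ snd snd); exact: cvg_snd.
    exact: eval_continuous.
(* A mixture of two mixtures: gather the parts from [A] and those from [B]. *)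
- move=> t _ _ t01 [[s [f g]] /= [+ [Af Bg]] <-]
    [[s' [f' g']] /= [+ [Af' Bg']] <-].
  rewrite !in_itv/= => s01 s'01; case/andP: (t01) => t0 t1.
  case/andP: s01 => s0 s1; case/andP: s'01 => s'0 s'1.
  have [||b b01 eb] := @weight_split ((1 - t) * s) (t * s').
  + by rewrite mulr_ge0// subr_ge0.
  + by rewrite mulr_ge0.
  have [||a a01 ea] := @weight_split ((1 - t) * (1 - s)) (t * (1 - s')).
  + by rewrite mulr_ge0// subr_ge0.
  + by rewrite mulr_ge0// subr_ge0.
  have -> : mix t (mix s f g) (mix s' f' g') =
      mix ((1 - t) * s + t * s') (mix a f f') (mix b g g').
    apply/funext => x; rewrite /mix.
    set u := (1 - t) * s + t * s' in eb *.
    transitivity ((1 - u - t * (1 - s')) * f x + t * (1 - s') * f' x +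
        ((u - t * s') * g x + t * s' * g' x)); first by rewrite /u; ring.
    by rewrite -eb -ea /u; ring.
  apply: inW; [nra|exact: mA|exact: mB].
- move=> f Af; have -> : f = mix 0 f g0 by apply/funext => x; rewrite /mix; ring.
  by apply: inW; rewrite ?lexx ?ler01.
- move=> g Bg; have -> : g = mix 1 f0 g by apply/funext => x; rewrite /mix; ring.
  by apply: inW; rewrite ?lexx ?ler01.
- move=> h [[s [f g]] /= [+ [Af Bg]] <-]; rewrite in_itv/= => s01.
  by apply: Or33; exists s, f, g.
Qed.

Lemma compact_joins (K : nat -> set fcts) (Z : set fcts) : mix_closed Z ->
  (forall i, [/\ compact (K i), mix_closed (K i) & K i `<=` Z]) ->
  forall n, exists W : set fcts, [/\ compact W, mix_closed W, W `<=` Z &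
    forall i, (i <= n)%N -> K i `<=` W].
Proof.
move=> mZ hK; elim=> [|n [W [cW mW WZ KW]]].
  have [cK mK KZ] := hK 0%N.
  by exists (K 0%N); split=> // i; rewrite leqn0 => /eqP->.
have [cK mK KZ] := hK n.+1.
have [V [cV mV WV KV Vsub]] := compact_join cW mW cK mK.
exists V; split=> //.
  move=> h /Vsub[/WZ//|/KZ//|[s [f [g [s01 Wf Kg ->]]]]].
  by apply: mZ => //; [exact: WZ|exact: KZ].
by move=> i; rewrite leq_eqVlt ltnS => /predU1P[->//|/KW Ki f /Ki /WV].
Qed.

End pointwise.

(** * Simons' inequality for decreasing sequences of closed convex sets *)

Lemma approx_min (R : realType) (T : Type) (A : set T) (f : T -> R)
    (d : R) : 0 < d ->
  A !=set0 -> (forall y, A y -> 0 <= f y) ->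
  exists2 y, A y & forall y', A y' -> f y <= f y' + d.
Proof.
move=> d0 [a Aa] f0.
have fi : has_inf (f @` A).
  by split; [exists (f a), a|exists 0 => _ [y Ay <-]; exact: f0].
have [_ [y Ay <-] yd] := inf_adherent d0 fi.
exists y => // y' Ay'; apply: le_trans (ltW yd) _; rewrite lerD2r.
by apply: ge_inf; [case: fi|exists y'].
Qed.

Section simons.
Context {R : realType} {E : completeNormedModType R}.
Variables (G : set (topdual E)) (X : nat -> set E) (U : set E).
Hypothesis X_closed : forall n, closed (X n).
Hypothesis X_bounded : forall x, X 0%N x -> `|x| <= 1.
Hypothesis X_decr : forall n, X n.+1 `<=` X n.
Hypothesis X_mid : forall n x y, X n x -> X n y -> X n (2^-1 *: (x + y)).
Hypothesis U_mid : forall x y, X 0%N x -> U x -> X 0%N y ->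
  U (2^-1 *: (x + y)).
Hypothesis XU_neq0 : forall n, X n `&` U !=set0.
Hypothesis G_max : forall x, X 0%N x -> U x -> exists g : topdual E,
  [/\ G g, 0 <= g x & forall h : topdual E, G h -> h x <= g x].

Let X_le m n : (m <= n)%N -> X n `<=` X m.
Proof.
elim: n => [|n IH]; first by rewrite leqn0 => /eqP->.
by rewrite leq_eqVlt ltnS => /predU1P[->//|/IH XX x /X_decr/XX].
Qed.

Let p x := sup [set g x | g in G].

Let pE x g : G g -> (forall h : topdual E, G h -> h x <= g x) -> p x = g x.
Proof.
move=> Gg gmax; apply/eqP; rewrite eq_le; apply/andP; split.
  by apply: ge_sup => [|_ [h Gh <-]]; [exists (g x), g|exact: gmax].
apply: ub_le_sup; last by exists g.
by exists (g x) => _ [h Gh <-]; exact: gmax.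
Qed.

Let p_ge0 x : X 0%N x -> U x -> 0 <= p x.
Proof.
by move=> Xx Ux; have [g [Gg g0 gm]] := G_max Xx Ux; rewrite (pE Gg).
Qed.

Let p_ub x (g : topdual E) : X 0%N x -> U x -> G g -> g x <= p x.
Proof.
move=> Xx Ux Gg; have [h [Gh h0 hm]] := G_max Xx Ux.
by rewrite (pE Gh)//; exact: hm.
Qed.

(** The weight that remains after the first [n] terms of
    [\sum_n 2^-n.+1 y_n]. *)
Let h (n : nat) : R := 2^-1 ^+ n.

Let h_gt0 n : 0 < h n. Proof. by rewrite exprn_gt0// invr_gt0. Qed.

Let hS n : h n.+1 = h n / 2. Proof. by rewrite /h exprSr. Qed.

Variables (r : R) (r_gt0 : 0 < r).

(** Given the partial sum [z], the next term is chosen as if it were to carry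
    the whole remaining weight.  The lower bound on [p] is a premise of the
    second clause because it holds only for the [z] met in the construction.
    The errors are scaled so that, once divided by [h n], they add up to less
    than [r]. *)
Let step n z : exists y, X n y /\ U y /\
  ((forall y', X n y' -> U y' -> 0 <= p (z + h n *: y')) ->
   forall y', X n y' -> U y' ->
   p (z + h n *: y) <= p (z + h n *: y') + h n * (h n.+1 * r)).
Proof.
have d0 : 0 < h n * (h n.+1 * r) by rewrite !mulr_gt0.
have [H|nH] := pselect (forall y', X n y' -> U y' -> 0 <= p (z + h n *: y')).
  have [y [Xy Uy] ymin] := approx_min d0 (XU_neq0 n)
    (fun y '(conj Xy Uy) => H y Xy Uy).
  by exists y; split=> //; split=> // _ y' Xy' Uy'; apply: ymin.
by have [y [Xy Uy]] := XU_neq0 n; exists y.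
Qed.

(** Let [z n] be the partial sums, [zl] their limit and [w n] the rescaled tail,
    so that [zl = z n + 2^-n w_n] and [w n] is the midpoint of [y n] and
    [w n.+1].  Let [g] attain [p zl].  Comparing [y n] with the competitor [w n],
    [g (z n + 2^-n y_n) <= p (z n + 2^-n y_n) <= p zl + small = g zl + small],
    so [g (y n)] is almost at most [g (w n)], and therefore [g (w n)] is almost
    at most [g (w n.+1)].  As [g (w 0) = p zl >= 0] and the errors add up to less
    than [r], every [w n] is a point of [X n] with [- r < g (w n)].
    The supremum is attained at [zl] because the tails stay in [U]: the first
    term [y n] of [w n] is in [U]. *)
Lemma simons_inequality :
  exists2 g, G g & forall n, exists2 x, X n x & - r < g x.
Proof.
have [Y Yspec] := choice (fun nz : nat * E => step nz.1 nz.2).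
pose fix z n : E := if n is m.+1 then z m + h m.+1 *: Y (m, z m) else 0.
pose y n := Y (n, z n).
have yX n : X n (y n) by have [] := Yspec (n, z n).
have yU n : U (y n) by have [_ []] := Yspec (n, z n).
have zS n : z n.+1 = z n + h n.+1 *: y n by [].
have halves n (a b : E) : h n.+1 *: a + h n.+1 *: b = h n *: (2^-1 *: (a + b)).
  by rewrite -scalerDr hS scalerA.
(* Midpoints suffice: [z n.+1 + h n.+1 *: x] is [z n + h n *: x'] with [x'] the
   midpoint of [y n] and [x]. *)
have zX n x : X 0%N x -> U x ->
    X 0%N (z n + h n *: x) /\ U (z n + h n *: x).
  elim: n x => [|n IH] x Xx Ux; first by rewrite add0r /h expr0 scale1r.
  rewrite zS -addrA halves; apply: IH.
    by apply: X_mid => //; exact: X_le (yX n).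
  by apply: U_mid => //; exact: X_le (yX n).
have ymin n x : X n x -> U x ->
    p (z n + h n *: y n) <= p (z n + h n *: x) + h n * (h n.+1 * r).
  have [_ [_ H]] := Yspec (n, z n); apply: H => x' Xx' Ux'.
  have [? ?] := zX n x' (X_le (leq0n n) Xx') Ux'.
  exact: p_ge0.
have z_cvg : cvgn z.
  have -> : z = series (fun n => h n.+1 *: y n).
    apply/funext; elim=> [|n IH]; first by rewrite /series /= big_geq.
    by rewrite seriesSr -IH zS addrC.
  apply: normed_cvg; apply: (@series_le_cvg _ _ (geometric (2^-1 : R) 2^-1)).
  - by move=> n; exact: normr_ge0.
  - by move=> n; rewrite /= mulr_ge0// exprn_ge0.
  - move=> n /=; rewrite -exprS normrZ gtr0_norm//.
    by rewrite ler_piMr ?(ltW (h_gt0 _))// X_bounded//; exact: X_le (yX n).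
  - by apply: is_cvg_geometric_series; rewrite gtr0_norm// invf_lt1// ltr1n.
pose zl : E := lim (z @ \oo).
pose w n := (h n)^-1 *: (zl - z n).
have zw n : zl = z n + h n *: w n.
  by rewrite scalerA divff ?gt_eqF// scale1r addrC subrK.
have wS n : w n = 2^-1 *: (y n + w n.+1).
  apply: (scalerI (lt0r_neq0 (h_gt0 n))).
  rewrite -halves /w !scalerA divff ?gt_eqF// divff ?gt_eqF// !scale1r zS.
  by rewrite [RHS]addrC opprD addrA subrK.
(* Finite tails completed by [y n] lie in [X n], and tend to [w n]. *)
have wX n : X n (w n).
  have XX m : forall x, X n x ->
      X n ((h n)^-1 *: (z (n + m)%N - z n) + h m *: x).
    elim: m => [|m IH] x Xx.
      by rewrite addn0 subrr scaler0 add0r /h expr0 scale1r.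
    have := IH _ (X_mid (X_le (leq_addr m n) (yX (n + m)%N)) Xx).
    rewrite -halves addrA addnS zS.
    congr (X n (_ + _)).
    rewrite addrAC [RHS]scalerDr scalerA; congr (_ + _ *: _).
    by rewrite /h -addnS exprD mulKf// gt_eqF//; exact: h_gt0.
  apply: (closed_cvg (FF := eventually_filter)
    (u_ := fun m => (h n)^-1 *: (z (n + m)%N - z n) + h m *: y n) (X n)) => //.
    by near=> m; exact: XX.
  rewrite -[X in _ --> X]addr0; apply: cvgD.
    apply: cvgZr; apply: cvgB; last exact: cvg_cst.
    suff : (fun m => z (m + n)%N) @ \oo --> zl.
      by apply: cvg_trans; apply: near_eq_cvg; near=> m; rewrite addnC.
    by rewrite cvg_shiftn.
  rewrite -(scale0r (y n)); apply: cvgZl; apply: cvg_expr.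
  by rewrite gtr0_norm// invf_lt1// ltr1n.
have wU n : U (w n).
  by rewrite wS; apply: U_mid => //; [exact: X_le (yX n)|exact: X_le (wX n.+1)].
have [g [Gg g0 gmax]] := G_max (wX 0%N) (wU 0%N).
exists g => // n; exists (w n) => //.
have pg : p zl = g zl.
  rewrite (zw 0%N) add0r /h expr0 scale1r.
  exact: pE.
have gy k : g (y k) <= g (w k) + h k.+1 * r.
  have := ymin k _ (wX k) (wU k); rewrite -zw pg {1}(zw k).
  have [X0 U0] := zX k (y k) (X_le (leq0n k) (yX k)) (yU k).
  move/(le_trans (p_ub X0 U0 Gg)).
  rewrite !linearD !linearZ/= -addrA lerD2l -mulrDr.
  by rewrite ler_pM2l.
have gw k : g (w k) <= g (w k.+1) + h k.+1 * r.
  have := gy k; have : g (w k) = 2^-1 * (g (y k) + g (w k.+1)).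
    by rewrite {1}wS linearZ linearD.
  by move=> ->; lra.
pose v k : R := g (w k).
have v_step k : v k <= v k.+1 + h k.+1 * r by exact: gw.
have : - r * (1 - h n) <= v n.
  elim: n => [|n IH]; first by rewrite /h expr0 subrr mulr0.
  by have := v_step n; rewrite hS; move: IH; move: (h n) => a; lra.
apply: lt_le_trans.
by have := mulr_gt0 r_gt0 (h_gt0 n); move: (h n) => a; lra.
Unshelve. all: by end_near. Qed.

End simons.

(** * Separation in the weak-star topology *)

Section weak_star_separation.
Context {R : realType} {E : normedModType R}.
Local Notation fcts := {ptws E -> R}.
Implicit Types (D K : set (topdual E)) (f g q : topdual E) (x : E).

Lemma weak_star_fun_continuous :
  continuous (@topdual_fun R E : weak_star E -> fcts).
Proof.
exact: (@initial_continuous (topdual E) {ptws E -> R^o} (@topdual_fun R E)).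
Qed.

Lemma weak_star_eval_continuous x :
  continuous (fun f : weak_star E => f x : R).
Proof.
move=> f; have h := @continuous_comp (weak_star E) fcts R
  (@topdual_fun R E) (fun h : fcts => h x) f.
by apply: h; [exact: weak_star_fun_continuous|exact: eval_continuous].
Qed.

Lemma convex_set_mix D f g (s : R) : @convex_set R (topdual E) D ->
  0 <= s <= 1 -> D f -> D g -> D ((1 - s) *: f + s *: g).
Proof.
move=> cD /andP[s0 s1] Df Dg.
have := cD g f (Itv01 s0 s1) (mem_set Dg) (mem_set Df).
by move/set_mem; rewrite addrC.
Qed.

Lemma mix_convex_set D : (forall f g s, 0 <= s <= 1 -> D f -> D g ->
  D ((1 - s) *: f + s *: g)) -> @convex_set R (topdual E) D.
Proof.
move=> hD f g s /set_mem Df /set_mem Dg; apply/mem_set.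
have := hD g f s%:num; rewrite addrC; apply => //.
by apply/andP; split; [exact: ge0|exact: le1].
Qed.

Lemma sub_convex_hull D : D `<=` convex_hull D.
Proof. exact: sub_gen_smallest. Qed.

Lemma convex_hull_convex D : @convex_set R (topdual E) (convex_hull D).
Proof.
apply: mix_convex_set => f g s s01 Df Dg C [cC DC].
by apply: convex_set_mix => //; [exact: Df|exact: Dg].
Qed.

(** The half-space [g x <= a] is convex and weak-star closed. *)
Lemma weak_star_closure_hull_le D f x (a : R) :
  (forall g, D g -> g x <= a) -> weak_star_closure (convex_hull D) f ->
  f x <= a.
Proof.
move=> Da; pose H : set (topdual E) := [set g | g x <= a].
have cH : closed (H : set (weak_star E)).
  apply: (@closed_comp _ _ (fun g : weak_star E => g x : R) [set y | y <= a]).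
    by move=> g _; exact: weak_star_eval_continuous.
  exact: closed_le.
rewrite /weak_star_closure => Df; suff : closure (H : set (weak_star E)) f.
  by move/cH.
apply: closure_subset Df; apply: smallest_sub => //.
apply: mix_convex_set => g h s /andP[s0 s1]; rewrite /H/= => ga ha.
suff : (1 - s) * g x + s * h x <= a by [].
have -> : a = (1 - s) * a + s * a by ring.
by apply: lerD; rewrite ler_wpM2l// subr_ge0.
Qed.

Lemma weak_star_closure_hull_neq0 D f :
  weak_star_closure (convex_hull D) f -> D !=set0.
Proof.
move=> Df; apply/set0P/eqP => D0.
suff h0 : convex_hull D = set0.
  move: Df; rewrite /weak_star_closure h0.
  by move=> /(_ setT)[|g []//]; exact: filterT.
apply/seteqP; split=> //; apply: smallest_sub; last by rewrite D0.
exact: mix_convex_set.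
Qed.

Lemma dual_norm_gt q (r : R) : r < dual_norm q ->
  exists2 x, `|x| <= 1 & q x < - r.
Proof.
move=> rq; have [x [x1 qx]] : exists x, `|x| <= 1 /\ r < `|q x|.
  apply: contrapT => h; move: rq; apply/negP; rewrite -leNgt.
  apply: dual_norm_le => x x1; rewrite leNgt; apply/negP => qx.
  by apply: h; exists x.
move: qx; rewrite ltr_normr => /orP[qx|qx]; last first.
  by exists x => //; rewrite ltrNr.
by exists (- x); rewrite ?normrN// linearN ltrN2.
Qed.

(** Continuous affine functions, for which the weights of a minimax theorem can
    be moved inside as a convex combination of points. *)
Definition affine (h : fcts) := exists q (a : R), h = fun x => q x + a.

(** The constant [a] puts sets of functionals with different thresholds on a
    common footing: the functions are to be made negative. *)
Definition translate q (a : R) f : fcts := fun x => f x - q x + a.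

Lemma translate_affine q a f : affine (translate q a f).
Proof. by exists (f - q), a. Qed.

Lemma affine_mix : mix_closed affine.
Proof.
move=> s _ _ _ [p [a ->]] [q [b ->]].
exists ((1 - s) *: p + s *: q), ((1 - s) * a + s * b).
apply/funext => x; rewrite /mix.
have -> : ((1 - s) *: p + s *: q) x = (1 - s) * p x + s * q x by [].
by move: (p x : R) (q x : R) => u v; ring.
Qed.

Lemma translate_mix q a D : @convex_set R (topdual E) D ->
  mix_closed (translate q a @` D).
Proof.
move=> cD s _ _ s01 [f Df <-] [g Dg <-].
exists ((1 - s) *: f + s *: g); first exact: convex_set_mix.
apply/funext => x; rewrite /mix /translate.
have -> : ((1 - s) *: f + s *: g) x = (1 - s) * f x + s * g x by [].
by move: (f x : R) (g x : R) (q x : R) => u v w; ring.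
Qed.

Lemma translate_compact q a D :
  weak_star_compact D -> compact (translate q a @` D).
Proof.
move=> cD; apply: (@continuous_compact (weak_star E) fcts) => //.
apply: continuous_subspaceT; apply: continuous_ptws => x f.
have cx := @weak_star_eval_continuous x f.
exact: (cvgD (cvgB cx (cvg_cst (q x))) (cvg_cst a)).
Qed.

(** The weights of the minimax theorem give a convex combination of points of
    the unit ball. *)
Lemma affine_minimax (A : set fcts) : compact A -> mix_closed A ->
  A `<=` affine -> (forall h, A h -> exists2 x, `|x| <= 1 & h x < 0) ->
  exists x (e : R), [/\ `|x| <= 1, 0 < e & forall h, A h -> h x <= - e].
Proof.
move=> cA mA Aaff Aneg.
have [->|/set0P A0] := eqVneq A set0.
  by exists 0, 1; split=> //; rewrite normr0.
have [xs [c [e [xs1 c0 c1 e0 le_e]]]] := compact_minimax cA mA A0 Aneg.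
exists (\sum_(x <- xs) c x *: x), e; split=> //.
  apply: (le_trans (ler_norm_sum _ _ _)); rewrite -c1 big_seq [leRHS]big_seq.
  apply: ler_sum => x /xs1 x1.
  by rewrite normrZ ger0_norm// ler_piMr.
move=> h Ah; have [q [a hE]] := Aaff _ Ah.
rewrite (le_trans _ (le_e _ Ah))// hE.
have -> : q (\sum_(x <- xs) c x *: x) = \sum_(x <- xs) c x * q x.
  by rewrite linear_sum; apply: eq_bigr => x _; rewrite linearZ.
rewrite -[X in _ + X]mul1r -c1 mulr_suml -big_split /=.
by under [leRHS]eq_bigr do rewrite mulrDr.
Qed.

(** The set to be made negative joins the functions [f - f0 + r], [f] in
    [K 0, ..., K n], to the functionals of [D].  Keeping [D] itself, rather than
    its cone, preserves compactness; the cone appears only when a mixture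
    [(1 - s) * (m - f0 + r) + s * d] is divided by [1 - s], whence the multiple
    [s / (1 - s)] of [d]. *)
Lemma cone_separation D (K : nat -> set (topdual E)) (f0 : topdual E) (r : R) :
  weak_star_compact D -> @convex_set R (topdual E) D -> ~ D 0 ->
  (forall i, weak_star_compact (K i)) ->
  (forall i, @convex_set R (topdual E) (K i)) ->
  (forall m l, convex_hull (\bigcup_i K i) m -> Lambda_ D l ->
     r < dual_norm (m + l - f0)) ->
  forall n, exists x, [/\ `|x| <= 1,
    exists2 e : R, 0 < e & forall d, D d -> d x <= - e &
    forall i f, (i <= n)%N -> K i f -> f x - f0 x + r <= 0].
Proof.
move=> cD vD D0 cK vK far n.
pose M : set (topdual E) := convex_hull (\bigcup_i K i).
have [i|W [cW mW WM KW]] := compact_joins (K := fun i => translate f0 r @` K i)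
    (translate_mix (q := f0) (a := r)
      (@convex_hull_convex (\bigcup_i K i))) _ n.
  split; [exact: translate_compact|exact: translate_mix|].
  by move=> _ [f Kf <-]; exists f => //; apply: sub_convex_hull; exists i.
have [V [cV mV WV DV Vsub]] := compact_join cW mW
  (translate_compact (q := 0) (a := 0) cD) (translate_mix (q := 0) (a := 0) vD).
have translate0 f x : translate 0 0 f x = f x by rewrite /translate subr0 addr0.
have negD d : D d -> exists2 x, `|x| <= 1 & translate 0 0 d x < 0.
  move=> Dd; have /dual_norm_gt[x x1 dx] : 0 < dual_norm d.
    rewrite lt_neqAle dual_norm_ge0 andbT eq_sym.
    apply/eqP => /dual_norm0_eq0 d0.
    by apply: D0; rewrite -d0.
  by exists x => //; rewrite translate0; move: dx; rewrite oppr0.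
have negM m l : M m -> Lambda_ D l ->
    exists2 x, `|x| <= 1 & translate f0 r m x + l x < 0.
  move=> Mm Ll; have [x x1 mlx] := dual_norm_gt (far _ _ Mm Ll).
  exists x => //; rewrite /translate; move: mlx.
  have -> : (m + l - f0) x = m x + l x - f0 x by [].
  by move: (m x : R) (l x : R) (f0 x : R) => a b c; lra.
have [||x [e [x1 e0 hx]]] := affine_minimax cV mV.
- move=> h /Vsub[/WM[m _ <-]|[d _ <-]|
      [s [_ [_ [s01 /WM[m _ <-] [d _ <-] ->]]]]];
    [exact: translate_affine|exact: translate_affine|].
  by apply: affine_mix => //; exact: translate_affine.
- move=> h /Vsub[/WM[m Mm <-]|[d Dd <-]|]; [|exact: negD|].
    have [x x1 mx] := negM _ _ Mm (or_introl erefl).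
    by exists x => //; move: mx; rewrite [X in _ + X](_ : _ = 0)// addr0.
  move=> [s [_ [_ [/andP[s0 s1] /WM[m Mm <-] [d Dd <-] ->]]]].
  have [->|s_neq1] := eqVneq s 1.
    have [x x1 dx] := negD _ Dd; exists x => //.
    by rewrite /mix subrr mul0r add0r mul1r.
  have s_lt1 : 0 < 1 - s by rewrite subr_gt0 lt_neqAle s_neq1.
  have Ll : Lambda_ D ((s / (1 - s)) *: d).
    have [->|s_neq0] := eqVneq s 0; first by left; rewrite mul0r scale0r.
    right; exists (s / (1 - s)); last by exists d.
    by rewrite /= divr_gt0// lt_neqAle eq_sym s_neq0.
  have [x x1 mdx] := negM _ _ Mm Ll.
  exists x => //; rewrite /mix translate0; move: mdx.
  have -> : ((s / (1 - s)) *: d) x = s / (1 - s) * d x by [].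
  rewrite -(pmulr_rlt0 _ s_lt1) mulrDr mulrA.
  by rewrite [X in X * d x]mulrC divfK// gt_eqF.
exists x; split=> //.
  by exists e => // d Dd; rewrite -translate0; apply: hx; apply: DV; exists d.
move=> i f le_in Kf.
apply: le_trans (_ : - e <= 0); last by rewrite oppr_le0 ltW.
by apply: (hx (translate f0 r f)); apply: WV; apply: (KW i) => //; exists f.
Qed.

End weak_star_separation.

(** * The theorem *)

Lemma closure_far (R : realType) (E : normedModType R) (A : set (topdual E))
    (f : topdual E) : ~ closure A f ->
  exists2 r : R, 0 < r & forall a, A a -> r < dual_norm (a - f).
Proof.
move=> nAf; apply: contrapT => far; apply: nAf => B /nbhs_ballP[e e0 eB].
apply: contrapT => AB; apply: far; exists (e / 2); first by rewrite divr_gt0.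
move=> a Aa; rewrite ltNge; apply/negP => ae; apply: AB; exists a; split=> //.
apply: eB; rewrite -ball_normE /= distrC.
by apply: le_lt_trans ae _; rewrite ltr_pdivrMr// ltr_pMr// ltr1n.
Qed.

(** The case [x = 0] has to be treated apart: [0] satisfies the bound on [D] when
    [D] is empty, but is excluded from [L_ D]. *)
Lemma attained_max (R : realType) (E : normedModType R) (D B : set (topdual E))
    (B_neq0 : B !=set0)
    (B_attained : forall x : E, L_ D x ->
      exists2 b : topdual E, B b &
        (b x)%:E = ereal_sup [set (c x)%:E | c in B]) (x : E) (e : R) :
  0 < e -> (forall d : topdual E, D d -> d x <= - e) ->
  exists2 b : topdual E, B b & forall c : topdual E, B c -> c x <= b x.
Proof.
move=> e0 Dx; have [->|x0] := eqVneq x 0.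
  by have [b Bb] := B_neq0; exists b => // c _; rewrite !linear0.
have [|b Bb bE] := B_attained x.
  rewrite /L_; case: asboolP => [_|_] /=; first exact/eqP.
  apply: (@le_lt_trans _ _ (- e)%:E); last by rewrite lte_fin oppr_lt0.
  by apply: ge_ereal_sup => _ [d Dd <-]; rewrite lee_fin; exact: Dx.
exists b => // c Bc; rewrite -lee_fin bE.
by apply: ereal_sup_ubound; exists c.
Qed.

Lemma closed_le_topdual (R : realType) (E : normedModType R) (f : topdual E)
  (a : R) : closed [set x | f x <= a].
Proof.
apply: (@closed_comp _ _ (f : E -> R) [set y | y <= a]); last exact: closed_le.
by move=> x _; exact: topdual_continuous.
Qed.

Theorem theorem6 (R : realType) (E : completeNormedModType R)
    (D B : set (topdual E)) (K : nat -> set (topdual E))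
    (D_compact : weak_star_compact D)
    (D_convex : @convex_set R (topdual E) D)
    (D_not0 : ~ D 0)
    (B_attained : forall x : E, L_ D x ->
      exists2 b : topdual E, B b &
        (b x)%:E = ereal_sup [set (c x)%:E | c in B])
    (K_compact : forall n, weak_star_compact (K n))
    (K_convex : forall n, @convex_set R (topdual E) (K n))
    (K_sub : forall n, K n `<=` weak_star_closure (convex_hull B))
    (B_sub : B `<=` \bigcup_n K n) :
  weak_star_closure (convex_hull B) `<=`
  closure [set x + y | x in convex_hull (\bigcup_n K n) & y in Lambda_ D].
Proof.
move=> f0 Cf0; apply: contrapT => /closure_far[r r0 far].
have sep := cone_separation D_compact D_convex D_not0 K_compact K_convex
  (fun m l Mm Ll => far (m + l)
    (ex_intro2 _ _ m Mm (ex_intro2 _ _ l Ll erefl))).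
pose G := [set b - f0 | b in B].
pose X n := [set x : E | `|x| <= 1] `&` \bigcap_(d in D) [set x | d x <= 0] `&`
  \bigcap_(i in [set i | (i <= n)%N]) \bigcap_(f in K i)
    [set x | (f - f0) x <= - r].
pose U := [set x : E | exists2 e : R, 0 < e &
  forall d : topdual E, D d -> d x <= - e].
have X_closed n : closed (X n).
  apply: closedI; [apply: closedI|].
  - apply: (@closed_comp _ _ (Num.norm : E -> R) [set y | y <= 1]);
      last exact: closed_le.
    by move=> x _; exact: norm_continuous.
  - by apply: closed_bigI => d _; exact: closed_le_topdual.
  - apply: closed_bigI => i _; apply: closed_bigI => f _.
    exact: closed_le_topdual.
have half (q : topdual E) (x y : E) : q (2^-1 *: (x + y)) = 2^-1 * (q x + q y).
  by rewrite linearZ linearD.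
have half_le (u v a : R) : u <= a -> v <= a -> 2^-1 * (u + v) <= a by lra.
have [||||||g [b Bb <-] gX] :=
    @simons_inequality R E G X U X_closed _ _ _ _ _ _ r r0.
- by move=> x [[]].
- move=> n x [xD xK]; split=> // i le_in; apply: xK; exact: leq_trans le_in _.
- move=> n x y [[x1 xD] xK] [[y1 yD] yK]; split; [split|].
  + rewrite /= normrZ ger0_norm//; apply: le_trans (half_le _ _ _ x1 y1).
    by rewrite ler_wpM2l// ler_normD.
  + by move=> d Dd; rewrite /mkset half; apply: half_le; [exact: xD|exact: yD].
  + move=> i le_in f Kf; rewrite /mkset half.
    by apply: half_le; [exact: xK Kf|exact: yK Kf].
- move=> x y _ [e e0 xe] [[_ yD] _]; exists (e / 2); first by rewrite divr_gt0.
  move=> d Dd; rewrite half; have := xe _ Dd; have : d y <= 0 := yD _ Dd.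
  by move: (d x : R) (d y : R) => u v; lra.
- move=> n; have [x [x1 [e e0 xe] xK]] := sep n.
  exists x; split; last by exists e.
  split; [split=> // d Dd|].
    by apply: le_trans (xe _ Dd) _; rewrite oppr_le0 ltW.
  move=> i le_in f Kf; have := xK _ _ le_in Kf.
  suff : f x - f0 x + r <= 0 -> f x - f0 x <= - r by [].
  by move: (f x : R) (f0 x : R) => u v; lra.
- move=> x _ [e e0 xe].
  have [b Bb bmax] := attained_max (weak_star_closure_hull_neq0 Cf0)
    B_attained e0 xe.
  exists (b - f0); split; first by exists b.
    have -> : (b - f0) x = b x - f0 x by [].
    by rewrite subr_ge0; exact: weak_star_closure_hull_le bmax Cf0.
  by move=> _ [c Bc <-]; apply: lerB => //; exact: bmax.
have [n _ Kb] := B_sub _ Bb.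
have [x [_ xK]] := gX n.
by rewrite ltNge => /negP; apply; exact: xK (leqnn n) _ Kb.
Qed.
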